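(* Let $\mathcal{S}_M=\{Z\in M(3,\mathbb{C}) : I-{}^t\overline{Z}Z>0\}$, with coordinates the entries $z_{ij}$ of $Z$. For $Z\in\mathcal{S}_M$ put $\Omega(Z)=f_1\wedge f_2\wedge f_3\in\bigwedge^3\mathbb{C}^6$ with $f_j=z_{1j}e_1+z_{2j}e_2+z_{3j}e_3+e_{j+3}$ $(j=1,2,3)$, a generator of the $(3,0)$-part $(W_{\mathbb{C},Z})^{3,0}$ of the Hodge structure of type $(1,9,9,1)$ over $Z$. For $s\in\mathbb{C}^*$ let $t_{00}$, $t_{ij}$, $F_{00}$, $F_{ij}$ ($1\le i,j\le3$) be the following coordinates of $s\,\Omega(Z)$: $t_{00}$ is the coefficient of $e_4\wedge e_5\wedge e_6$; $t_{ij}$ is the coefficient of $e_i\wedge e_k\wedge e_l$ with $k<l$ and $\{k,l\}=\{4,5,6\}\setminus\{j+3\}$; $F_{00}$ is the coefficient of $e_1\wedge e_2\wedge e_3$; $F_{ij}$ is the coefficient of $e_k\wedge e_l\wedge e_{j+3}$ with $k<l$ and $\{k,l\}=\{1,2,3\}\setminus\{i\}$. Set $\overline{t}_{00}=t_{00}$ and $\overline{t}_{ij}=(-1)^{i+j+1}t_{ij}$ (the bar is only notation, not complex conjugation). Then: 1. $t_{00}=s$, $t_{ij}=s(-1)^{j+1}z_{ij}$, $F_{00}=s\det Z$ and $F_{ij}=s(-1)^{i+1}\frac{\partial}{\partial z_{ij}}\det Z$. 2. In these coordinates the symplectic form induced by the wedge pairing $Q$ is $Q=dF_{00}\wedge d\overline{t}_{00}+\sum_{i,j=1}^3dF_{ij}\wedge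 d\overline{t}_{ij}$. 3. The function $$\mathcal{F}=-\frac{\det(\overline{t}_{ij})_{i,j=1,2,3}}{\overline{t}_{00}}$$ is a holomorphic prepotential: $F_{00}=\frac{\partial\mathcal{F}}{\partial\overline{t}_{00}}$ and $F_{ij}=\frac{\partial\mathcal{F}}{\partial\overline{t}_{ij}}$ for all $i,j\in\{1,2,3\}$. 4. The cubic form (Yukawa coupling) is given, for $\xi=\sum_{i,j=1}^3\lambda_{ij}\frac{\partial}{\partial z_{ij}}$ with $\lambda_{ij}\in\mathbb{C}$, by $$Q(\Omega,\xi\xi\xi\,\Omega)=-6\det(\lambda_{ij}).$$
   Context: $e_1,\dots,e_6$ is the standard basis of $\mathbb{C}^6$. $Q$ is the alternating form on $\bigwedge^3\mathbb{C}^6$ defined by $\alpha\wedge\beta=Q(\alpha,\beta)\,e_1\wedge\cdots\wedge e_6$. The 20 coefficients listed in the claim are the coordinates on $\bigwedge^3\mathbb{C}^6$ with respect to the basis $e_a\wedge e_b\wedge e_c$ ($a<b<c$), and the expression of $Q$ as a two-form in item 2 refers to these coordinates on $\bigwedge^3\mathbb{C}^6$. The Hodge structure over $Z\in\mathcal{S}_M$: $(V_+)_Z=\langle f_1,f_2,f_3\rangle$ and $(V_-)_Z=\langle g_1,g_2,g_3\rangle$, where $g_i=e_i+\overline{z_{i1}}e_4+\overline{z_{i2}}e_5+\overline{z_{i3}}e_6$ (here bar is complex conjugation), and $(W_{\mathbb{C},Z})^{p,q}=\bigwedge^p(V_+)_Z\otimes\bigwedge^q(V_-)_Z\subset\bigwedge^3\mathbb{C}^6$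 for $p+q=3$. In item 4, $\xi\xi\xi\,\Omega$ is the vector obtained by differentiating the $\bigwedge^3\mathbb{C}^6$-valued holomorphic function $\Omega(Z)$ three times along the constant-coefficient vector field $\xi$. *)

(* Defs.v *)
From HB Require Import structures.
From mathcomp Require Import all_boot all_order all_algebra.
From mathcomp Require Import complex.
From mathcomp Require Import all_classical all_reals all_analysis.

Set Implicit Arguments.
Unset Strict Implicit.
Unset Printing Implicit Defensive.

Import Order.TTheory GRing.Theory Num.Theory.
Import numFieldNormedType.Exports.

Local Open Scope ring_scope.
Local Open Scope sesquilinear_scope.

(* The field of complex numbers. R[i] itself carries no topology in the
   libraries, whereas any numClosedFieldType gets the one given by its norm. *)
Definition CC (R : realType) : numClosedFieldType := R[i].

(** * The exterior powers of K^n *)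

(* The k-th exterior power of K^n is modelled as the space of row vectors
   whose entries are indexed by the k-element subsets of 'I_n: the entry at
   {a_1 < ... < a_k} is the coefficient of e_{a_1} /\ ... /\ e_{a_k}. The first
   exterior power is K^n itself. Row vectors carry both the algebraic and the
   normed module structures of the libraries. *)
Definition ksub (n k : nat) := {A : {set 'I_n} | #|A| == k}.

Notation ext K n k := ('rV[K]_#|{: ksub n k}|).

Section Exterior.
Context {K : fieldType} {n : nat}.

(* Coefficient of the basis vector e_A; it is 0 unless #|A| = k. *)
Definition coef {k} (u : ext K n k) (A : {set 'I_n}) : K :=
  oapp (fun B : ksub n k => u 0 (enum_rank B)) 0 (insub A).

Definition ebase {k} (A : {set 'I_n}) : ext K n k :=
  \row_c (val (enum_val c) == A)%:R.

(* e_A /\ e_B = (-1)^(inversions A B) e_(A :|: B) when A and B are disjoint. *)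
Definition inversions (A B : {set 'I_n}) : nat :=
  (\sum_(a in A) \sum_(b in B) (b < a))%N.

Definition wedge {p q} (u : ext K n p) (v : ext K n q) : ext K n (p + q) :=
  \row_c let C : {set 'I_n} := val (enum_val c : ksub n (p + q)) in
    \sum_(A : {set 'I_n} | (A \subset C) && (#|A| == p))
      (-1) ^+ inversions A (C :\: A) * coef u A * coef v (C :\: A).

(* Span of the products u /\ v with u in U and v in V (wedge being bilinear,
   bases suffice). *)
Definition wedgev {p q} (U : {vspace ext K n p}) (V : {vspace ext K n q}) :
    {vspace ext K n (p + q)} :=
  <<[seq wedge u v | u <- vbasis U, v <- vbasis V]>>%VS.

Fixpoint extpow (p : nat) (U : {vspace ext K n 1}) : {vspace ext K n p} :=
  if p is p'.+1 then wedgev U (extpow p' U) else fullv.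

End Exterior.

(** * The third exterior power of C^6 *)

(* Indices run over 'I_3 = {0, 1, 2}; C^6 is indexed by 'I_(3 + 3), so that
   e_i is [elo i] and e_{j+3} is [ehi j]. Signs are written with the 1-based
   indices i.+1 and j.+1. *)
Notation L3 K := (ext K (3 + 3) 3).

Section LambdaThree.
Context {K : numClosedFieldType}.

Definition lo (i : 'I_3) : 'I_(3 + 3) := lshift 3 i.
Definition hi (j : 'I_3) : 'I_(3 + 3) := rshift 3 j.
Definition elo (i : 'I_3) : ext K (3 + 3) 1 := ebase [set lo i].
Definition ehi (j : 'I_3) : ext K (3 + 3) 1 := ebase [set hi j].

Definition los : {set 'I_(3 + 3)} := [set lo i | i : 'I_3].
Definition his : {set 'I_(3 + 3)} := [set hi j | j : 'I_3].

(* The basis vector e_1 /\ ... /\ e_6 is the one indexed by the full set. *)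
Definition Q (u v : L3 K) : K := coef (wedge u v) [set: 'I_(3 + 3)].

(* e_i /\ e_k /\ e_l (k < l in {4,5,6} minus j+3) and e_k /\ e_l /\ e_{j+3}
   (k < l in {1,2,3} minus i) are increasing products, so they are the basis
   vectors indexed by the sets below, without sign. *)
Definition t00 (w : L3 K) : K := coef w his.
Definition t (i j : 'I_3) (w : L3 K) : K := coef w (lo i |: (his :\ hi j)).
Definition F00 (w : L3 K) : K := coef w los.
Definition F (i j : 'I_3) (w : L3 K) : K := coef w (hi j |: (los :\ lo i)).

Definition tbar00 (w : L3 K) : K := t00 w.
Definition tbar (i j : 'I_3) (w : L3 K) : K :=
  (-1) ^+ (i.+1 + j.+1 + 1) * t i j w.
Definition tbarmx (w : L3 K) : 'M[K]_3 := \matrix_(i, j) tbar i j w.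

Definition f (Z : 'M[K]_3) (j : 'I_3) : ext K (3 + 3) 1 :=
  \sum_i Z i j *: elo i + ehi j.

Definition Omega (Z : 'M[K]_3) : L3 K :=
  wedge (wedge (f Z 0) (f Z 1)) (f Z 2).

(* The prepotential, as a function of (tbar_00, (tbar_ij)). *)
Definition prepotential (x : K * 'M[K]_3) : K := - (\det x.2 / x.1).

End LambdaThree.

(** * The domain, the Hodge structure and complex derivatives *)

Section Complex.
Context {K : numClosedFieldType}.

(* In K, 0 < x means that x is real and positive. *)
Definition posdefmx {n} (A : 'M[K]_n) : Prop :=
  forall v : 'cV[K]_n, v != 0 -> 0 < (v ^t* *m A *m v) 0 0.

Definition SM : set 'M[K]_3 := [set Z | posdefmx (1%:M - Z ^t* *m Z)]%classic.

Definition g (Z : 'M[K]_3) (i : 'I_3) : ext K (3 + 3) 1 :=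
  elo i + \sum_k (Z i k)^* *: ehi k.

Definition Vplus (Z : 'M[K]_3) : {vspace ext K (3 + 3) 1} :=
  <<[seq f Z j | j : 'I_3]>>%VS.
Definition Vminus (Z : 'M[K]_3) : {vspace ext K (3 + 3) 1} :=
  <<[seq g Z i | i : 'I_3]>>%VS.

(* Lambda^p V_+ (x) Lambda^q V_-, embedded in Lambda^(p+q) by the wedge
   product. *)
Definition hodge (p q : nat) (Z : 'M[K]_3) : {vspace ext K (3 + 3) (p + q)} :=
  wedgev (extpow p (Vplus Z)) (extpow q (Vminus Z)).

(* The partial derivative d/dz_ij and the vector field
   sum_ij lambda_ij d/dz_ij. The base field being K = C, these are complex
   derivatives. *)
Definition ddz {W : normedModType K} (i j : 'I_3) (h : 'M[K]_3 -> W) :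
    'M[K]_3 -> W :=
  fun Z => 'D_(delta_mx i j) h Z.

Definition vfield {W : normedModType K} (lambda : 'M[K]_3)
    (h : 'M[K]_3 -> W) : 'M[K]_3 -> W :=
  fun Z => \sum_i \sum_j lambda i j *: ddz i j h Z.

(* The value at w, on the tangent vectors u and v, of the two-form
   d phi /\ d psi. *)
Definition dwedge {V : normedModType K} (phi psi : V -> K) (w u v : V) : K :=
  'd phi w u * 'd psi w v - 'd phi w v * 'd psi w u.

End Complex.

(* Main.v *)
Require Import Defs.
From HB Require Import structures.
From mathcomp Require Import all_boot all_order all_algebra.
From mathcomp Require Import complex ring zify.
From mathcomp Require Import all_classical all_reals all_analysis.
(* Reimported to take precedence over the homonyms in classical_sets. *)
From mathcomp Require Import fintype finset perm.
Import Order.TTheory GRing.Theory Num.Theory.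
Import numFieldNormedType.Exports.
Local Open Scope ring_scope.

(* Every identity about Omega reduces to its coordinates, which are the minors of
   the 6 x 3 matrix with columns f_1, f_2, f_3.

   For Z in S_M the matrix I - Z^* Z is invertible, so V_+ + V_- is all of C^6.
   Expanding e_a /\ e_b /\ e_c along this sum shows that the four Hodge pieces
   span the exterior cube; they have dimension at most 1, 9, 9, 1, and these
   bounds add up to 20, so all of them are attained and the sum is direct.

   Q pairs e_A with e_(~: A); the 20 triples A fall into ten complementary pairs,
   which are the pairs of coordinates (F_00, t_00) and (F_ij, t_ij).

   Along any line the functions to differentiate are polynomial of degree at most
   3 (det and the prepotential are even affine along a matrix unit), so derivatives
   are read off an expansion. Since Omega is trilinear in its factors, which are
   affine in Z, xi xi xi Omega = 6 l_1 /\ l_2 /\ l_3 with l_j = sum_i lambda_ij e_i,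
   that is 6 det(lambda) e_1 /\ e_2 /\ e_3. *)

Set Implicit Arguments.
Unset Strict Implicit.
Unset Printing Implicit Defensive.

(** * Coefficients and the wedge product *)

Section Coef.
Context {K : fieldType} {n : nat}.
Implicit Types (A B C : {set 'I_n}).

Lemma coef_out k (u : ext K n k) A : #|A| != k -> coef u A = 0.
Proof. by move=> hA; rewrite /coef insubF //; apply/negbTE. Qed.

Lemma ext_coefE k (u : ext K n k) c : u 0 c = coef u (val (enum_val c)).
Proof. by rewrite /coef valK /= enum_valK. Qed.

Lemma ext_eqP k (u v : ext K n k) : coef u =1 coef v -> u = v.
Proof. by move=> uv; apply/rowP => c; rewrite !ext_coefE uv. Qed.

Lemma coef_row k (h : {set 'I_n} -> K) A : #|A| = k ->
  coef (\row_c h (val (enum_val c)) : ext K n k) A = h A.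
Proof.
move=> hA; have hA' : #|A| == k by rewrite hA.
by rewrite /coef insubT /= mxE enum_rankK.
Qed.

(** The target is [K^o] so that the coefficient is a linear map in the sense of the library and the
    rules below follow from the general ones. *)
Definition coef_at k A (u : ext K n k) : K^o := coef u A.

Fact coef_at_is_linear k A : linear (@coef_at k A).
Proof.
move=> a u v /=; rewrite /coef_at /coef; case: insub => [B|] /=;
  first by rewrite !mxE.
by rewrite scaler0 addr0.
Qed.

HB.instance Definition _ k A :=
  GRing.isLinear.Build K (ext K n k) K^o _ (@coef_at k A)
    (@coef_at_is_linear k A).

Lemma coef_extD k (u v : ext K n k) A : coef (u + v) A = coef u A + coef v A.
Proof. exact: (linearD (@coef_at k A)). Qed.

Lemma coef_extN k (u : ext K n k) A : coef (- u) A = - coef u A.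
Proof. exact: (linearN (@coef_at k A)). Qed.

Lemma coef_extZ k a (u : ext K n k) A : coef (a *: u) A = a * coef u A.
Proof. exact: (linearZ_LR (@coef_at k A)). Qed.

Lemma coef_ext0 k A : coef (0 : ext K n k) A = 0.
Proof. exact: (linear0 (@coef_at k A)). Qed.

Lemma coef_ext_sum k I (r : seq I) (P : pred I) (h : I -> ext K n k) A :
  coef (\sum_(i <- r | P i) h i) A = \sum_(i <- r | P i) coef (h i) A.
Proof. exact: (linear_sum (@coef_at k A)). Qed.

Lemma coef_ebase k A B : #|A| = k -> coef (ebase A : ext K n k) B = (B == A)%:R.
Proof.
move=> hA; have [hB|hB] := eqVneq #|B| k.
  exact: (@coef_row k (fun C => (C == A)%:R)).
rewrite coef_out //; case: eqP => // BA; by rewrite BA hA eqxx in hB.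
Qed.

Lemma ext_sum_ebase k (u : ext K n k) :
  u = \sum_(A : {set 'I_n} | #|A| == k) coef u A *: ebase A.
Proof.
apply: ext_eqP => B; rewrite coef_ext_sum.
have [hB|hB] := eqVneq #|B| k; last first.
  rewrite coef_out // big1 // => A /eqP hA.
  rewrite coef_extZ coef_ebase //; case: eqP => [BA|_]; last by rewrite mulr0.
  by rewrite BA hA eqxx in hB.
rewrite (bigD1 B) /= ?hB // coef_extZ coef_ebase // eqxx mulr1 big1 ?addr0 //.
by move=> A /andP[/eqP hA hAB]; rewrite coef_extZ coef_ebase // eq_sym
  (negbTE hAB) mulr0.
Qed.

End Coef.

(** * Bilinearity, associativity and graded commutativity of the wedge product *)

Section Wedge.
Context {K : fieldType} {n : nat}.
Implicit Types (A B C : {set 'I_n}).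

Lemma coef_wedge p q (u : ext K n p) (v : ext K n q) C :
  coef (wedge u v) C = \sum_(A : {set 'I_n} | A \subset C)
    (-1) ^+ inversions A (C :\: A) * coef u A * coef v (C :\: A).
Proof.
have [hC|hC] := eqVneq #|C| (p + q)%N; last first.
  rewrite coef_out // big1 // => A sAC.
  have [hA|hA] := eqVneq #|A| p; last by rewrite (coef_out u) // mulr0 mul0r.
  rewrite (coef_out v) ?mulr0 // cardsD (setIidPr sAC) hA.
  by apply: contraNneq hC => <-; rewrite subnKC // -hA subset_leq_card.
rewrite (@coef_row K n _ (fun C => \sum_(A : {set 'I_n} | (A \subset C) && (#|A| == p))
      (-1) ^+ inversions A (C :\: A) * coef u A * coef v (C :\: A))) //.
rewrite big_mkcondr /=; apply: eq_bigr => A _; case: ifPn => // hA.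
by rewrite coef_out // mulr0 mul0r.
Qed.

Lemma sum_disjointU A B (h : 'I_n -> nat) : [disjoint A & B] ->
  (\sum_(i in A :|: B) h i = \sum_(i in A) h i + \sum_(i in B) h i)%N.
Proof. by move=> AB; rewrite -bigU //; apply: eq_bigl => i; rewrite !inE. Qed.

Lemma inversionsUl A B C : [disjoint A & B] ->
  inversions (A :|: B) C = (inversions A C + inversions B C)%N.
Proof. exact: sum_disjointU. Qed.

Lemma inversionsUr A B C : [disjoint B & C] ->
  inversions A (B :|: C) = (inversions A B + inversions A C)%N.
Proof.
move=> BC; rewrite /inversions -big_split /=.
by apply: eq_bigr => a _; rewrite sum_disjointU.
Qed.

(** Disjointness makes the two entries of each pair distinct, so every pair is counted on exactly
    one side. *)
Lemma inversionsC A B : [disjoint A & B] ->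
  (inversions A B + inversions B A = #|A| * #|B|)%N.
Proof.
move=> AB; rewrite /inversions [X in (_ + X)%N]exchange_big -big_split /=.
rewrite -sum_nat_const; apply: eq_bigr => a aA.
rewrite -big_split /= -sum1_card; apply: eq_bigr => b bB.
have : a != b by apply: contraTneq bB => <-; rewrite (disjointFr AB).
by rewrite -val_eqE /= neq_ltn; case: ltngtP.
Qed.

Lemma inversionss0 A : inversions A set0 = 0%N.
Proof. by rewrite /inversions big1 // => a _; rewrite big_set0. Qed.

Fact wedge_is_linear p q (u : ext K n p) : linear (wedge u : ext K n q -> _).
Proof.
move=> a v w; apply: ext_eqP => C.
rewrite coef_extD coef_extZ !coef_wedge mulr_sumr -big_split /=.
by apply: eq_bigr => A _; rewrite coef_extD coef_extZ mulrDr mulrCA.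
Qed.

HB.instance Definition _ p q (u : ext K n p) :=
  GRing.isLinear.Build K (ext K n q) (ext K n (p + q)) _ (wedge u)
    (@wedge_is_linear p q u).

(** The arguments are swapped so that linearity in the left factor is also available as an
    instance. *)
Definition wedger p q (v : ext K n q) (u : ext K n p) := wedge u v.

Fact wedger_is_linear p q (v : ext K n q) : linear (@wedger p q v).
Proof.
move=> a u w; apply: ext_eqP => C.
rewrite coef_extD coef_extZ !coef_wedge mulr_sumr -big_split /=.
by apply: eq_bigr => A _; rewrite coef_extD coef_extZ mulrDr mulrDl mulrCA !mulrA.
Qed.

HB.instance Definition _ p q (v : ext K n q) :=
  GRing.isLinear.Build K (ext K n p) (ext K n (p + q)) _ (wedger v)
    (@wedger_is_linear p q v).

Lemma wedgeDr p q (u : ext K n p) (v w : ext K n q) :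
  wedge u (v + w) = wedge u v + wedge u w.
Proof. exact: linearD. Qed.

Lemma wedgeDl p q (v w : ext K n p) (u : ext K n q) :
  wedge (v + w) u = wedge v u + wedge w u.
Proof. exact: (linearD (wedger u)). Qed.

Lemma wedgeZr p q a (u : ext K n p) (v : ext K n q) :
  wedge u (a *: v) = a *: wedge u v.
Proof. exact: linearZ. Qed.

Lemma wedgeZl p q a (u : ext K n p) (v : ext K n q) :
  wedge (a *: u) v = a *: wedge u v.
Proof. exact: (linearZ_LR (wedger v)). Qed.

Lemma wedgeNr p q (u : ext K n p) (v : ext K n q) : wedge u (- v) = - wedge u v.
Proof. exact: linearN. Qed.

Lemma wedgeNl p q (u : ext K n p) (v : ext K n q) : wedge (- u) v = - wedge u v.
Proof. exact: (linearN (wedger v)). Qed.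

Lemma wedge0r p q (u : ext K n p) : wedge u (0 : ext K n q) = 0.
Proof. exact: linear0. Qed.

Lemma wedge0l p q (v : ext K n q) : wedge (0 : ext K n p) v = 0.
Proof. exact: (linear0 (wedger v)). Qed.

(* Stated on coefficients because associativity, unitality and
   commutativity relate vectors of non-convertible types. *)
Lemma coef_wedgeA p q r (u : ext K n p) (v : ext K n q) (w : ext K n r) :
  coef (wedge (wedge u v) w) =1 coef (wedge u (wedge v w)).
Proof.
move=> C; rewrite !coef_wedge.
under eq_bigr => A _ do rewrite coef_wedge mulr_sumr mulr_suml.
under [RHS]eq_bigr => A _ do rewrite coef_wedge mulr_sumr.
rewrite (exchange_big_dep (fun B => B \subset C)) /=; last first.
  by move=> A B sAC BA; exact: (fintype.subset_trans _ sAC).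
apply: eq_bigr => A sAC.
(* A set containing [A] is written [A :|: B] with [B] disjoint from [A]: both sides become sums over
   splittings of [C] into three blocks. *)
rewrite (reindex_onto (fun B => A :|: B) (fun B => B :\: A)) /=; last first.
  by by move=> B /andP[_ AB]; rewrite -{1}(setIidPr AB) setID.
apply: eq_big => [B|B].
  rewrite subUset sAC subsetUl andbT /= subsetD; congr (_ && _).
  rewrite setDUl setDv set0U disjoint_sym -setI_eq0.
  apply/eqP/eqP => [BA|AB]; last by apply/setDidPl; rewrite -setI_eq0 setIC AB.
  by apply/eqP; rewrite setI_eq0 disjoint_sym; apply/setDidPl.
move=> /andP[/andP[ABC _] /eqP BA].
have dBA : [disjoint B & A].
  by rewrite setDUl setDv set0U in BA; apply/setDidPl.
have dAB : [disjoint A & B] by rewrite disjoint_sym.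
have BC : B \subset C by move: ABC; rewrite subUset => /andP[].
rewrite BA setDDl.
have -> : C :\: A = B :|: (C :\: (A :|: B)).
  apply/setP => x; rewrite !inE; case: (boolP (x \in B)) => [xB|_] /=.
    by rewrite (disjointFr dBA xB) (subsetP BC).
  by rewrite orbF.
(* Both signs count the inversions between the three pairs of blocks. *)
rewrite inversionsUl // inversionsUr; last first.
  by rewrite disjoints_subset; apply/subsetP => x xB; rewrite !inE xB orbT.
rewrite !exprD.
ring.
Qed.

(** Complementation in [C] matches the two sums, and by [inversionsC] the two signs differ by
    (-1)^(pq). *)
Lemma coef_wedgeC p q (u : ext K n p) (v : ext K n q) C :
  coef (wedge u v) C = (-1) ^+ (p * q) * coef (wedge v u) C.
Proof.
rewrite !coef_wedge mulr_sumr (reindex_onto (setD C) (setD C)) /=; last first.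
  by move=> A sAC; rewrite setDDr setDv set0U (setIidPr sAC).
apply: eq_big => [A|A /andP[_ /eqP CA]].
  rewrite subsetDl setDDr setDv set0U /=; apply/eqP/idP => [<-|/setIidPr //].
  exact: subsetIl.
rewrite CA; have sAC : A \subset C by rewrite -CA subsetDl.
have [hA|hA] := eqVneq #|A| q; last by rewrite (coef_out v) // !(mulr0, mul0r).
have [hB|hB] := eqVneq #|C :\: A| p; last first.
  by rewrite (coef_out u) // !(mulr0, mul0r).
have dA : [disjoint A & C :\: A].
  by rewrite -setI_eq0 setIDA setIC -setIDA setDv setI0.
have -> : (p * q = inversions A (C :\: A) + inversions (C :\: A) A)%N.
  by rewrite inversionsC // hA hB mulnC.
rewrite exprD; set x := (-1) ^+ inversions A _; set y := (-1) ^+ _.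
have xx : x * x = 1 by rewrite -expr2 sqrr_sign.
rewrite [RHS](_ : _ = x * x * (y * coef u (C :\: A) * coef v A)); last by ring.
by rewrite xx mul1r.
Qed.

Definition ext_unit : ext K n 0 := ebase set0.

Lemma coef_wedge_unitr p (u : ext K n p) : coef (wedge u ext_unit) =1 coef u.
Proof.
move=> C; rewrite coef_wedge (bigD1 C) //= setDv inversionss0 mul1r.
rewrite coef_ebase ?cards0 // eqxx mulr1 big1 ?addr0 // => A /andP[sAC nAC].
rewrite coef_ebase ?cards0 // setD_eq0; case: (boolP (C \subset A)) => CA.
  by rewrite eqEsubset sAC CA in nAC.
by rewrite mulr0.
Qed.

Lemma wedge_ebase p q A B : #|A| = p -> #|B| = q -> [disjoint A & B] ->
  wedge (ebase A : ext K n p) (ebase B : ext K n q) =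
    (-1) ^+ inversions A B *: ebase (A :|: B).
Proof.
move=> hA hB AB; have hAB : #|A :|: B| = (p + q)%N.
  by rewrite cardsU (eqP (_ : A :&: B == set0)) ?setI_eq0 // cards0 subn0 hA hB.
apply: ext_eqP => C; rewrite coef_extZ coef_ebase // coef_wedge.
under eq_bigr => D _ do rewrite !coef_ebase //.
have [->|nC] := eqVneq C (A :|: B).
  rewrite (bigD1 A) ?subsetUl //= eqxx setDUl setDv set0U.
  rewrite (setDidPl _); last by rewrite disjoint_sym.
  rewrite eqxx !mulr1 big1 ?addr0 // => D /andP[_ /negbTE ->].
  by rewrite mulr0 mul0r.
rewrite mulr0 big1 // => D DC; case: eqP => [DA|]; last by rewrite mulr0 mul0r.
case: eqP => [CB|]; last by rewrite mulr0.
by case/eqP: nC; rewrite -DA -CB -{1}(setIidPr DC) setID.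
Qed.

End Wedge.

(** * Products of subspaces and dimensions *)

Section WedgeSpan.
Context {K : fieldType} {n : nat}.

(** Bilinearity passes from the basis vectors used in [wedgev] to arbitrary elements. *)
Lemma mem_wedgev p q (U : {vspace ext K n p}) (V : {vspace ext K n q}) u v :
  u \in U -> v \in V -> wedge u v \in wedgev U V.
Proof.
move=> uU vV; rewrite (coord_vbasis uU) (coord_vbasis vV) linear_sum /=.
apply: memv_suml => j _; rewrite wedgeZr memvZ //.
rewrite -/(wedger _ _) linear_sum /=; apply: memv_suml => i _.
rewrite linearZ memvZ //=; apply: memv_span.
by apply: allpairs_f; apply: mem_nth; rewrite size_tuple.
Qed.

(** Inclusion can be tested on any generating lists, such as the vectors f_j, instead of the bases
    chosen by [vbasis]. *)
Lemma wedgev_span_sub p q X Y (W : {vspace ext K n (p + q)}) :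
  (forall (u : ext K n p) (v : ext K n q), u \in X -> v \in Y -> wedge u v \in W) ->
  (wedgev <<X>> <<Y>> <= W)%VS.
Proof.
move=> h; apply/span_subvP => _ /allpairsP[[u v] /= [uX vY ->]].
have /(coord_span (X := in_tuple Y)) -> := vbasis_mem vY; rewrite linear_sum /=.
apply: memv_suml => j _; rewrite wedgeZr memvZ //.
have /(coord_span (X := in_tuple X)) -> := vbasis_mem uX;
  rewrite -/(wedger _ _) linear_sum /=.
apply: memv_suml => i _; rewrite linearZ memvZ //=; apply: h; exact: mem_nth.
Qed.

Lemma wedgev_sub p q (U : {vspace ext K n p}) (V : {vspace ext K n q})
    (W : {vspace ext K n (p + q)}) :
  (forall (u : ext K n p) (v : ext K n q), u \in U -> v \in V -> wedge u v \in W) ->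
  (wedgev U V <= W)%VS.
Proof.
move=> h; rewrite -(span_basis (vbasisP U)) -(span_basis (vbasisP V)).
by apply: wedgev_span_sub => u v /vbasis_mem uU /vbasis_mem vV; exact: h.
Qed.

Lemma dim_wedgev p q (U : {vspace ext K n p}) (V : {vspace ext K n q}) :
  (\dim (wedgev U V) <= \dim U * \dim V)%N.
Proof. by apply: leq_trans (dim_span _) _; rewrite size_allpairs !size_tuple. Qed.

Lemma dim_ext k : \dim {: ext K n k} = 'C(n, k).
Proof.
rewrite dimvf dim_matrix [LHS]mul1r card_sig.
rewrite (_ : 'C(n, k) = 'C(#|'I_n|, k)); last by rewrite card_ord.
by rewrite -card_draws cardsE.
Qed.

End WedgeSpan.

(** * Wedge products of vectors *)

Section WedgeOne.
Context {K : fieldType} {n : nat}.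
Implicit Types (A B C : {set 'I_n}) (a b c : 'I_n).

Lemma ext1_eqP (u v : ext K n 1) :
  (forall a, coef u [set a] = coef v [set a]) -> u = v.
Proof.
move=> uv; apply: ext_eqP => A; have [hA|hA] := eqVneq #|A| 1%N.
  by have /cards1P[a ->] : #|A| == 1%N by rewrite hA.
by rewrite !coef_out.
Qed.

(** Laplace expansion along [x]: only singletons contribute from the degree 1 factor. *)
Lemma coef_wedge1 p (x : ext K n 1) (v : ext K n p) C :
  coef (wedge x v) C = \sum_(a in C)
    (-1) ^+ inversions [set a] (C :\ a) * coef x [set a] * coef v (C :\ a).
Proof.
rewrite coef_wedge (bigID (fun A : {set 'I_n} => #|A| == 1%N)) /= addrC big1; last first.
  by move=> A /andP[_ hA]; rewrite (coef_out x) // mulr0 mul0r.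
rewrite add0r -(big_imset (fun A => (-1) ^+ inversions A (C :\: A) * coef x A
  * coef v (C :\: A)) (in2W set1_inj)) /=.
apply: eq_bigl => A; apply/andP/imsetP => [[sAC /cards1P[a Aa]]|[a aC ->]].
  by exists a => //; rewrite -sub1set -Aa.
by rewrite sub1set cards1.
Qed.

Lemma inversions1 a B : inversions [set a] B = (\sum_(b in B) (b < a))%N.
Proof. by rewrite /inversions big_set1. Qed.

Lemma coef_wedge11 (x y : ext K n 1) a b : (a < b)%N ->
  coef (wedge x y) (a |: [set b]) =
    coef x [set a] * coef y [set b] - coef x [set b] * coef y [set a].
Proof.
move=> ab; have nab : a != b by rewrite -val_eqE /= neq_ltn ab.
rewrite coef_wedge1 big_setU1 ?inE //= big_set1.
have -> : (a |: [set b]) :\ a = [set b].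
  by rewrite setU1K // inE.
have -> : (a |: [set b]) :\ b = [set a].
  by rewrite setUC setU1K // inE eq_sym.
rewrite !inversions1 !big_set1 ab ltnNge (ltnW ab) /=.
by ring.
Qed.

(** This is the 3 x 3 minor, in rows [a], [b], [c], of the matrix with columns [x], [y], [z]. *)
Lemma coef_wedge111 (x y z : ext K n 1) a b c : (a < b)%N -> (b < c)%N ->
  coef (wedge (wedge x y) z) (a |: (b |: [set c])) =
    coef x [set a] * coef y [set b] * coef z [set c]
    - coef x [set a] * coef y [set c] * coef z [set b]
    - coef x [set b] * coef y [set a] * coef z [set c]
    + coef x [set b] * coef y [set c] * coef z [set a]
    + coef x [set c] * coef y [set a] * coef z [set b]
    - coef x [set c] * coef y [set b] * coef z [set a].
Proof.
move=> ab bc; have ac := ltn_trans ab bc.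
have nab : a != b by rewrite -val_eqE /= neq_ltn ab.
have nac : a != c by rewrite -val_eqE /= neq_ltn ac.
have nbc : b != c by rewrite -val_eqE /= neq_ltn bc.
rewrite coef_wedgeA coef_wedge1 big_setU1 ?inE ?negb_or ?nab //=.
rewrite big_setU1 ?inE //= big_set1.
have -> : (a |: (b |: [set c])) :\ a = b |: [set c].
  by rewrite setU1K // !inE negb_or nab.
have -> : (a |: (b |: [set c])) :\ b = a |: [set c].
  by rewrite setUCA setU1K // !inE negb_or eq_sym nab.
have -> : (a |: (b |: [set c])) :\ c = a |: [set b].
  rewrite setUA setUC setU1K // !inE negb_or.
  by rewrite eq_sym nac eq_sym nbc.
rewrite !inversions1 !big_setU1 ?inE //= !big_set1 !coef_wedge11 //.
rewrite ab bc ac !ltnNge (ltnW ab) (ltnW ac) (ltnW bc) /=.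
by ring.
Qed.

Lemma wedge111A (x y z : ext K n 1) :
  wedge x (wedge y z) = wedge (wedge x y) z :> ext K n 3.
Proof. by apply: ext_eqP => A; exact: esym (coef_wedgeA x y z A). Qed.

Lemma wedge11C (x y : ext K n 1) : wedge x y = - wedge y x.
Proof. by apply: ext_eqP => A; rewrite coef_wedgeC coef_extN mulN1r. Qed.

Lemma wedge111CA (x y z : ext K n 1) :
  wedge x (wedge y z) = - wedge y (wedge x z) :> ext K n 3.
Proof. by rewrite !wedge111A [wedge x y]wedge11C wedgeNl. Qed.

Lemma wedge_unitr1 (x : ext K n 1) : wedge x ext_unit = x :> ext K n 1.
Proof. by apply: ext_eqP => A; exact: (coef_wedge_unitr x A). Qed.

Lemma wedge_unitr3 (x : ext K n 3) : wedge x ext_unit = x :> ext K n 3.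
Proof. by apply: ext_eqP => A; exact: (coef_wedge_unitr x A). Qed.

Lemma wedge_unitl p (x : ext K n p) : wedge ext_unit x = x.
Proof. by apply: ext_eqP => A; rewrite coef_wedgeC mul0n mul1r coef_wedge_unitr. Qed.

Lemma ext0_scale (x : ext K n 0) : x = coef x set0 *: ext_unit.
Proof.
rewrite {1}(ext_sum_ebase x) (bigD1 set0) ?cards0 //= big1 ?addr0 // => A.
by rewrite cards_eq0 => /andP[->].
Qed.

(** The recursion ends on the full space of degree 0, whose elements are scalar multiples of the
    unit. *)
Lemma extpow1 (U : {vspace ext K n 1}) : extpow 1 U = U.
Proof.
apply/eqP; rewrite eqEsubv; apply/andP; split; last first.
  by apply/subvP => u uU; rewrite -[u]wedge_unitr1;
    exact: (mem_wedgev uU (memvf ext_unit)).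
apply: (@wedgev_sub _ _ 1 0) => u v uU _.
by rewrite (ext0_scale v) wedgeZr wedge_unitr1 memvZ.
Qed.

Lemma mem_extpow2 (U : {vspace ext K n 1}) u v :
  u \in U -> v \in U -> wedge u v \in extpow 2 U.
Proof.
by move=> uU vU; apply: mem_wedgev => //; rewrite -/(extpow 1 U) extpow1.
Qed.

Lemma mem_extpow3 (U : {vspace ext K n 1}) u v w :
  u \in U -> v \in U -> w \in U -> wedge u (wedge v w) \in extpow 3 U.
Proof. by move=> uU vU wU; apply: mem_wedgev => //; exact: mem_extpow2. Qed.

End WedgeOne.

(** * Alternation and dimension bounds for exterior powers of a span of three vectors *)

Section Char0.
Context {K : numFieldType} {n : nat}.

(** Anticommutativity makes the square its own opposite, and 2 is invertible in [K]. *)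
Lemma wedge11_eq0 (x : ext K n 1) : wedge x x = 0.
Proof.
apply: ext_eqP => A; rewrite coef_ext0; apply/eqP.
by rewrite -eqNr -coef_extN -wedge11C.
Qed.

Lemma ord3P (P : 'I_3 -> Prop) : P 0 -> P 1 -> P 2 -> forall i, P i.
Proof.
move=> P0 P1 P2 [[|[|[|//]]] h].
- by rewrite (_ : Ordinal h = 0) //; exact: val_inj.
- by rewrite (_ : Ordinal h = 1) //; exact: val_inj.
- by rewrite (_ : Ordinal h = 2) //; exact: val_inj.
Qed.

Variable h : 'I_3 -> ext K n 1.
Let U := <<[seq h j | j : 'I_3]>>%VS.

Lemma extpow2_sub :
  (extpow 2 U <= <<[:: wedge (h 0%R) (h 1%R); wedge (h 0%R) (h 2%R);
                       wedge (h 1%R) (h 2%R)]>>)%VS.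
Proof.
set W := <<_>>%VS.
have h01 : wedge (h 0) (h 1) \in W by rewrite memv_span // !inE eqxx.
have h02 : wedge (h 0) (h 2) \in W by rewrite memv_span // !inE eqxx ?orbT.
have h12 : wedge (h 1) (h 2) \in W by rewrite memv_span // !inE eqxx ?orbT.
rewrite (_ : extpow 2 U = wedgev U (extpow 1 U)) // extpow1.
apply: (@wedgev_span_sub _ _ 1 1) => u v /imageP[i _ ->] /imageP[j _ ->] {u v}.
elim/ord3P: i; elim/ord3P: j; rewrite ?wedge11_eq0 ?mem0v //.
- by rewrite wedge11C memvN.
- by rewrite wedge11C memvN.
- by rewrite wedge11C memvN.
Qed.

Lemma dim_extpow2_le : (\dim (extpow 2 U) <= 3)%N.
Proof. exact: leq_trans (dimvS extpow2_sub) (dim_span _). Qed.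

(** Among the nine products of a generator with a generator of the square, those with a repeated
    factor vanish and the other three agree up to sign. *)
Lemma extpow3_sub : (extpow 3 U <= <[wedge (wedge (h 0%R) (h 1%R)) (h 2%R)]>)%VS.
Proof.
rewrite (_ : extpow 3 U = wedgev U (extpow 2 U)) //.
set X := [:: wedge (h 0) (h 1); wedge (h 0) (h 2); wedge (h 1) (h 2)].
apply: (@subv_trans _ _ (wedgev U <<X>>)).
  apply: (@wedgev_sub _ _ 1 2) => u v uU vU.
  by rewrite mem_wedgev // (subvP extpow2_sub).
apply: (@wedgev_span_sub _ _ 1 2) => u v /imageP[i _ ->].
have z (x y : ext K n 1) : wedge x (wedge x y) = 0 :> ext K n 3.
  by rewrite wedge111A wedge11_eq0 wedge0l.
have z' (x y : ext K n 1) : wedge x (wedge y x) = 0 :> ext K n 3.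
  by rewrite [wedge y x]wedge11C wedgeNr z oppr0.
rewrite !inE => /or3P[] /eqP -> {v}; elim/ord3P: i;
  rewrite ?z ?z' ?mem0v //.
- rewrite wedge111CA [wedge (h 2) (h 1)]wedge11C wedgeNr opprK wedge111A.
  exact: memv_line.
- by rewrite wedge111CA memvN wedge111A memv_line.
- by rewrite wedge111A memv_line.
Qed.

Lemma dim_extpow3_le : (\dim (extpow 3 U) <= 1)%N.
Proof.
by apply: leq_trans (dimvS extpow3_sub) _; rewrite dim_vline; case: (_ != _).
Qed.

Lemma dim_extpow1_le : (\dim (extpow 1 U) <= 3)%N.
Proof.
by rewrite extpow1; apply: leq_trans (dim_span _) _; rewrite size_image card_ord.
Qed.

Lemma dim_extpow0 : \dim (extpow 0 U) = 1%N.
Proof. by rewrite dim_ext bin0. Qed.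

End Char0.

(** * Triples of indices and coordinates of Omega *)

Section LambdaThreeSets.

Lemma loP (P : 'I_(3 + 3) -> Prop) :
  (forall k, P (lo k)) -> (forall k, P (hi k)) -> forall a, P a.
Proof. by move=> Pl Ph a; rewrite -(splitK a); case: (fintype.split a). Qed.

Lemma eq_lo i j : (lo i == lo j) = (i == j).
Proof. exact: eq_lshift. Qed.

Lemma eq_hi i j : (hi i == hi j) = (i == j).
Proof. exact: eq_rshift. Qed.

Lemma eq_lohi i j : (lo i == hi j) = false.
Proof. exact: eq_lrshift. Qed.

Lemma eq_hilo i j : (hi i == lo j) = false.
Proof. exact: eq_rlshift. Qed.

Lemma lo_los k : lo k \in los.
Proof. exact: imset_f. Qed.

Lemma hi_los k : hi k \in los = false.
Proof. by apply/imsetP => -[j _ /eqP]; rewrite eq_hilo. Qed.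

Lemma hi_his k : hi k \in his.
Proof. exact: imset_f. Qed.

Lemma lo_his k : lo k \in his = false.
Proof. by apply/imsetP => -[j _ /eqP]; rewrite eq_lohi. Qed.

Definition lohiE := (eq_lo, eq_hi, eq_lohi, eq_hilo, lo_los, hi_los, hi_his, lo_his).

(* The set of the 20 triples of indices, as 10 complementary pairs. *)
Definition triple (x : bool * option ('I_3 * 'I_3)) : {set 'I_(3 + 3)} :=
  match x with
  | (true, None) => los
  | (false, None) => his
  | (true, Some (i, j)) => hi j |: (los :\ lo i)
  | (false, Some (i, j)) => lo i |: (his :\ hi j)
  end.

Lemma tripleC b o : triple (~~ b, o) = ~: triple (b, o).
Proof.
apply/setP; apply: loP => k; case: b; case: o => [[i j]|] /=;
  by rewrite !inE !lohiE ?andbT ?andbF ?orbF ?negbK.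
Qed.

Lemma card_los : #|los| = 3%N.
Proof. by rewrite card_imset ?card_ord //; exact: lshift_inj. Qed.

Lemma card_his : #|his| = 3%N.
Proof. by rewrite card_imset ?card_ord //; exact: rshift_inj. Qed.

Lemma card_triple x : #|triple x| = 3%N.
Proof.
case: x => -[] [[i j]|] /=; rewrite ?card_los ?card_his //.
- rewrite cardsU1 !inE !lohiE ?andbF /=; move: (cardsD1 (lo i) los).
  by rewrite lo_los card_los => <-.
- rewrite cardsU1 !inE !lohiE ?andbF /=; move: (cardsD1 (hi j) his).
  by rewrite hi_his card_his => <-.
Qed.

(** The four kinds of triples contain 3, 2, 1 or 0 low indices; in the mixed kinds the low and high
    indices present then reveal [i] and [j]. *)
Lemma triple_inj : injective triple.
Proof.
move=> x y /setP xy.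
have hl k := xy (lo k); have hh k := xy (hi k).
move: x y {xy} hl hh => [b [[i j]|]] [b' [[i' j']|]] hl hh.
- have bb : b = b'.
    case: b b' hl hh => -[] // hl hh.
      move: (hl 0) (hl 1) (hl 2) => /=; rewrite !inE !lohiE.
      by elim/ord3P: i {hl hh}; elim/ord3P: i'.
    move: (hl 0) (hl 1) (hl 2) => /=; rewrite !inE !lohiE.
    by elim/ord3P: i {hl hh}; elim/ord3P: i'.
  case: b' bb hl hh => -> hl hh.
    move: (hl i) (hh j) => /=; rewrite !inE !lohiE !eqxx /= ?orbF ?andbT.
    by move=> /esym/negbFE/eqP -> /esym/eqP ->.
  move: (hl i) (hh j) => /=; rewrite !inE !lohiE !eqxx /= ?orbF ?andbT ?andbF.
  by move=> /esym/eqP -> /esym/negbFE/eqP ->.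
- exfalso; move: (hl 0) (hl 1) (hl 2) => /=.
  by case: b hl hh => hl hh; case: b' hl hh => _ _ /=; rewrite !inE !lohiE;
    elim/ord3P: i.
- exfalso; move: (hl 0) (hl 1) (hl 2) => /=.
  by case: b hl hh => hl hh; case: b' hl hh => _ _ /=; rewrite !inE !lohiE;
    elim/ord3P: i'.
- by move: (hl 0); case: b {hl hh}; case: b' => /=; rewrite !lohiE.
Qed.

(** One inclusion suffices, since 2 (1 + 9) = 20 is the number of 3-element subsets of a 6-element
    set. *)
Lemma triples : [set A : {set 'I_(3 + 3)} | #|A| == 3%N] = [set triple x | x : _].
Proof.
apply/esym/eqP; rewrite eqEcard; apply/andP; split.
  by apply/subsetP => _ /imsetP[x _ ->]; rewrite inE card_triple.
rewrite card_draws card_ord card_imset; last exact: triple_inj.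
by rewrite card_prod card_bool card_option card_prod !card_ord.
Qed.

Lemma inversions_lohis : inversions los his = 0%N.
Proof.
rewrite /inversions big1 // => _ /imsetP[i _ ->]; rewrite big1 // => _ /imsetP[j _ ->].
by rewrite /= ltnNge (leq_trans (ltnW (ltn_ord i))) ?leq_addr.
Qed.

(** This parity is what the sign in [tbar] compensates. It is checked on the nine pairs after
    expanding the sums. *)
Lemma inversions_triple i j :
  odd (inversions (triple (true, Some (i, j))) (triple (false, Some (i, j)))) =
  odd (i.+1 + j.+1 + 1).
Proof.
rewrite /inversions big_mkcond big_split_ord /=.
under eq_bigr => a _ do rewrite -/(lo a) !inE !lohiE big_mkcond big_split_ord /=.
under [X in (_ + X)%N]eq_bigr => a _ do
  rewrite -/(hi a) !inE !lohiE big_mkcond big_split_ord /=.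
rewrite !big_ord_recl !big_ord0 /=.
rewrite -!/(lo _) -!/(hi _) !inE !lohiE.
by elim/ord3P: i; elim/ord3P: j.
Qed.

(** Increasing enumerations, here and for the other kinds of triples below, are the form required by
    [coef_wedge111]. *)
Lemma los3 : los = lo 0 |: (lo 1 |: [set lo 2]).
Proof.
by apply/setP; apply: loP; apply: ord3P; rewrite !inE !lohiE.
Qed.

Lemma his3 : his = hi 0 |: (hi 1 |: [set hi 2]).
Proof.
by apply/setP; apply: loP; apply: ord3P; rewrite !inE !lohiE.
Qed.

(* The two indices other than [i], in increasing order; their values are the
   lifts used by [cofactor]. *)
Definition fst_other (i : 'I_3) : 'I_3 := if i == 0 then 1 else 0.
Definition snd_other (i : 'I_3) : 'I_3 := if i == 2 then 1 else 2.

Lemma tset3 i j : lo i |: (his :\ hi j) =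
  lo i |: (hi (fst_other j) |: [set hi (snd_other j)]).
Proof.
by apply/setP; apply: loP; apply: ord3P; rewrite !inE !lohiE //;
  elim/ord3P: j.
Qed.

Lemma Fset3 i j : hi j |: (los :\ lo i) =
  lo (fst_other i) |: (lo (snd_other i) |: [set hi j]).
Proof.
by apply/setP; apply: loP; apply: ord3P; rewrite !inE !lohiE //;
  elim/ord3P: i; rewrite ?orbF.
Qed.

End LambdaThreeSets.

(** * The pairing in coordinates and the minors giving the coordinates of Omega *)

Section LambdaThree.
Context {K : numClosedFieldType}.
Implicit Types (Z : 'M[K]_3).

Lemma Q_expand (u v : L3 K) :
  Q u v = F00 u * t00 v - t00 u * F00 v
    + \sum_(i < 3) \sum_(j < 3) (-1) ^+ (i.+1 + j.+1 + 1) *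
        (F i j u * t i j v - t i j u * F i j v).
Proof.
pose s A := (-1) ^+ inversions A (~: A) * coef u A * coef v (~: A).
have sE (A : {set 'I_(3 + 3)}) : #|A| = 3%N ->
    s A + s (~: A) = (-1) ^+ inversions A (~: A) *
      (coef u A * coef v (~: A) - coef u (~: A) * coef v A).
  move=> hA; rewrite /s setCK.
  have hC : #|~: A| = 3%N by rewrite cardsCs setCK hA card_ord.
  (* Here #|A| * #|~: A| = 9 is odd, so exchanging [A] with its complement reverses the sign. *)
  have : (-1) ^+ (inversions A (~: A) + inversions (~: A) A) = - 1 :> K.
    rewrite inversionsC; last by rewrite -setI_eq0 setICr.
    by rewrite hA hC -signr_odd.
  rewrite exprD; set x := (-1) ^+ _; set y := (-1) ^+ _ => xy.
  have -> : y = - x.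
    have xx : x * x = 1 by rewrite -expr2 sqrr_sign.
    by rewrite -[y]mul1r -xx -mulrA xy mulrN1.
  by ring.
rewrite /Q coef_wedge.
transitivity (\sum_(A in [set A : {set 'I_(3 + 3)} | #|A| == 3%N]) s A).
  rewrite [RHS]big_mkcond; apply: eq_big => [A|A _]; first by rewrite subsetT.
  rewrite inE; case: eqP => [_|/eqP hA]; first by rewrite /s setTD.
  by rewrite (coef_out u) // mulr0 mul0r.
rewrite triples big_imset /=; last by move=> x y _ _; exact: triple_inj.
transitivity (\sum_o \sum_b s (triple (b, o))).
  by rewrite exchange_big pair_big /=; apply: eq_big => [[b o]|[b o] _]; rewrite ?inE.
rewrite (bigD1 None) //= big_bool /= -[his]/(triple (~~ true, None)) tripleC.
rewrite sE ?card_los //.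
rewrite -tripleC inversions_lohis mul1r; congr (_ + _).
(* The default [(0, 0)] is never reached, the label [None] having been split off. *)
rewrite [RHS]pair_big (reindex_onto (@Some ('I_3 * 'I_3)) (odflt (0, 0))) /=;
  last by case.
apply: eq_big => [[i j]|[i j] _]; first by rewrite eqxx.
transitivity (s (triple (true, Some (i, j))) + s (triple (~~ true, Some (i, j)))).
  by rewrite big_bool.
rewrite tripleC sE ?card_triple //.
by rewrite -tripleC -signr_odd inversions_triple signr_odd.
Qed.

Lemma coef_f_lo Z j k : coef (f Z j) [set lo k] = Z k j.
Proof.
rewrite /f coef_extD coef_ext_sum coef_ebase ?cards1 // (inj_eq set1_inj) lohiE addr0.
rewrite (bigD1 k) //= coef_extZ coef_ebase ?cards1 // eqxx mulr1 big1 ?addr0 //.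
move=> i ik; rewrite coef_extZ coef_ebase ?cards1 // (inj_eq set1_inj) lohiE.
by rewrite eq_sym (negbTE ik) mulr0.
Qed.

Lemma coef_f_hi Z j k : coef (f Z j) [set hi k] = (k == j)%:R.
Proof.
rewrite /f coef_extD coef_ext_sum coef_ebase ?cards1 // (inj_eq set1_inj) lohiE.
rewrite big1 ?add0r // => i _.
by rewrite coef_extZ coef_ebase ?cards1 // (inj_eq set1_inj) lohiE mulr0.
Qed.

Lemma coef_g_lo Z i k : coef (g Z i) [set lo k] = (k == i)%:R.
Proof.
rewrite /g coef_extD coef_ext_sum coef_ebase ?cards1 // (inj_eq set1_inj) lohiE.
rewrite big1 ?addr0 // => j _.
by rewrite coef_extZ coef_ebase ?cards1 // (inj_eq set1_inj) lohiE mulr0.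
Qed.

Lemma coef_g_hi Z i k : coef (g Z i) [set hi k] = (Z i k)^*.
Proof.
rewrite /g coef_extD coef_ext_sum coef_ebase ?cards1 // (inj_eq set1_inj) lohiE add0r.
rewrite (bigD1 k) //= coef_extZ coef_ebase ?cards1 // eqxx mulr1 big1 ?addr0 //.
move=> j jk; rewrite coef_extZ coef_ebase ?cards1 // (inj_eq set1_inj) lohiE.
by rewrite eq_sym (negbTE jk) mulr0.
Qed.

Lemma cofactor3 Z i j : cofactor Z i j = (-1) ^+ (i + j) *
  (Z (fst_other i) (fst_other j) * Z (snd_other i) (snd_other j)
   - Z (fst_other i) (snd_other j) * Z (snd_other i) (fst_other j)).
Proof.
have l0 (k : 'I_3) : lift k (0 : 'I_2) = fst_other k.
  by elim/ord3P: k; exact: val_inj.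
have l1 (k : 'I_3) : lift k (1 : 'I_2) = snd_other k.
  by elim/ord3P: k; exact: val_inj.
rewrite {1}/cofactor (expand_det_row _ 0) !big_ord_recl big_ord0 /cofactor !det_mx11 !mxE.
have -> : lift 0 0 = 1 :> 'I_2 by exact: val_inj.
have -> : lift 1 0 = 0 :> 'I_2 by exact: val_inj.
rewrite !l0 !l1 /=; ring.
Qed.

Lemma det3 Z : \det Z =
  Z 0 0 * (Z 1 1 * Z 2 2 - Z 1 2 * Z 2 1)
  - Z 0 1 * (Z 1 0 * Z 2 2 - Z 1 2 * Z 2 0)
  + Z 0 2 * (Z 1 0 * Z 2 1 - Z 1 1 * Z 2 0).
Proof.
have -> : \det Z = Z 0 0 * cofactor Z 0 0 + Z 0 1 * cofactor Z 0 1
                   + Z 0 2 * cofactor Z 0 2.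
  rewrite (expand_det_row _ 0) !big_ord_recl big_ord0 addr0 addrA.
  rewrite (_ : lift ord0 (lift ord0 ord0) = 2 :> 'I_3); last exact: val_inj.
  by rewrite (_ : lift ord0 ord0 = 1 :> 'I_3) //; exact: val_inj.
rewrite !cofactor3 /=; ring.
Qed.

Lemma F00_Omega Z : F00 (Omega Z) = \det Z.
Proof. by rewrite /F00 los3 coef_wedge111 // !coef_f_lo det3; ring. Qed.

Lemma t00_Omega Z : t00 (Omega Z) = 1.
Proof. by rewrite /t00 his3 coef_wedge111 // !coef_f_hi /=; ring. Qed.

(** Moving column [j] to the front, past [j] columns counted from 0, makes the minor triangular with
    diagonal entries z_ij, 1, 1. *)
Lemma t_Omega Z i j : t i j (Omega Z) = (-1) ^+ (j.+1 + 1) * Z i j.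
Proof.
rewrite /t tset3 coef_wedge111; first last.
- by elim/ord3P: j.
- by rewrite /= ltn_addr.
by rewrite !coef_f_hi !coef_f_lo; elim/ord3P: j; rewrite /= ; ring.
Qed.

(** Expanding along the row of [hi j] gives (-1)^j times the minor of [Z] without row [i] and column
    [j]; the sign inside the cofactor leaves (-1)^i, with indices from 0. *)
Lemma F_Omega Z i j : F i j (Omega Z) = (-1) ^+ (i.+1 + 1) * cofactor Z i j.
Proof.
rewrite /F Fset3 coef_wedge111; first last.
- by rewrite /= ltn_addr.
- by elim/ord3P: i.
rewrite !coef_f_hi !coef_f_lo cofactor3.
by elim/ord3P: i; elim/ord3P: j; rewrite /fst_other /snd_other /=; ring.
Qed.

End LambdaThree.

(** * The Hodge decomposition *)

Section Hodge.
Context {K : numClosedFieldType}.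
Local Open Scope sesquilinear_scope.
Variable Z : 'M[K]_3.

(** On a nonzero kernel vector the form would take the value 0. *)
Lemma posdef_unitmx n (A : 'M[K]_n) : posdefmx A -> A \in unitmx.
Proof.
move=> pA; rewrite -unitmx_tr -row_free_unit -kermx_eq0; apply/rowV0P => u.
move=> /sub_kermxP uA; apply/eqP; apply: contraT => u0.
have /pA : u^T != 0 by rewrite trmx_eq0.
by rewrite -mulmxA -[A]trmxK -trmx_mul uA trmx0 mulmx0 mxE ltxx.
Qed.

Lemma f_Vplus j : f Z j \in Vplus Z.
Proof. by apply: memv_span; exact: image_f. Qed.

Lemma g_Vminus i : g Z i \in Vminus Z.
Proof. by apply: memv_span; exact: image_f. Qed.

Lemma Vplus_Vminus : SM Z -> (Vplus Z + Vminus Z = fullv)%VS.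
Proof.
move=> hZ; apply/eqP; rewrite eqEsubv subvf; apply/subvP => x _ /=.
pose M := 1%:M - Z ^t* *m Z.
have uM : M \in unitmx by exact: posdef_unitmx.
pose p : 'cV[K]_3 := \col_i coef x [set lo i].
pose q : 'cV[K]_3 := \col_i coef x [set hi i].
(* The coordinates must satisfy p = Z a + b and q = a + Z^* b; eliminating b gives M a = q - Z^*
   p. *)
pose a := invmx M *m (q - Z ^t* *m p).
pose b := p - Z *m a.
have -> : x = \sum_j a j 0 *: f Z j + \sum_i b i 0 *: g Z i.
  have sum_delta (c : 'I_3 -> K) k : \sum_i c i * (k == i)%:R = c k.
    rewrite (bigD1 k) //= eqxx mulr1 big1 ?addr0 // => i ik.
    by rewrite eq_sym (negbTE ik) mulr0.
  apply: ext1_eqP; apply: loP => k; rewrite coef_extD !coef_ext_sum.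
    transitivity (\sum_j Z k j * a j 0 + \sum_i b i 0 * (k == i)%:R); last first.
      congr (_ + _); apply: eq_bigr => i _; rewrite coef_extZ ?coef_g_lo //.
      by rewrite coef_f_lo mulrC.
    have : (Z *m a + b) k 0 = p k 0 by rewrite addrC subrK.
    by rewrite sum_delta mxE [(Z *m a) _ _]mxE [p _ _]mxE => <-.
  transitivity (\sum_j a j 0 * (k == j)%:R + \sum_i (Z ^t*) k i * b i 0); last first.
    congr (_ + _); apply: eq_bigr => i _; rewrite coef_extZ ?coef_f_hi //.
    by rewrite coef_g_hi mulrC !mxE.
  have : (a + Z ^t* *m b) k 0 = q k 0.
    rewrite /b mulmxBr mulmxA addrCA -[a in a - _]mul1mx -mulmxBl -/M.
    by rewrite /a mulKVmx // addrC subrK.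
  by rewrite sum_delta mxE [(_ *m b) _ _]mxE [q _ _]mxE => <-.
apply: memv_add; apply: memv_suml => i _; apply: memvZ.
  exact: f_Vplus.
exact: g_Vminus.
Qed.

Local Notation P := (Vplus Z).
Local Notation M := (Vminus Z).

(** All four types are stated for the same right-nested product, so that a single expansion serves
    in [hodge_sum_full]; the missing degree 0 factor is the unit. *)
Lemma mem_hodge30 x y w : x \in P -> y \in P -> w \in P ->
  wedge x (wedge y w) \in (hodge 3 0 Z : {vspace L3 K}).
Proof.
move=> xP yP wP; rewrite -[wedge x _]wedge_unitr3.
by apply: (mem_wedgev (p := 3) (q := 0)); rewrite ?memvf //; exact: mem_extpow3.
Qed.

Lemma mem_hodge21 x y w : x \in P -> y \in P -> w \in M ->
  wedge x (wedge y w) \in (hodge 2 1 Z : {vspace L3 K}).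
Proof.
move=> xP yP wM; rewrite wedge111A.
by apply: (mem_wedgev (p := 2) (q := 1)); rewrite ?extpow1 //; exact: mem_extpow2.
Qed.

Lemma mem_hodge12 x y w : x \in P -> y \in M -> w \in M ->
  wedge x (wedge y w) \in (hodge 1 2 Z : {vspace L3 K}).
Proof.
move=> xP yM wM.
by apply: (mem_wedgev (p := 1) (q := 2)); rewrite ?extpow1 //; exact: mem_extpow2.
Qed.

Lemma mem_hodge03 x y w : x \in M -> y \in M -> w \in M ->
  wedge x (wedge y w) \in (hodge 0 3 Z : {vspace L3 K}).
Proof.
move=> xM yM wM; rewrite -[wedge x _]wedge_unitl.
by apply: (mem_wedgev (p := 0) (q := 3)); rewrite ?memvf //; exact: mem_extpow3.
Qed.

Local Notation H := ((hodge 3 0 Z : {vspace L3 K}) + hodge 2 1 Z + hodge 1 2 Z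
  + hodge 0 3 Z)%VS.

Lemma hodge_sum_full : SM Z -> H = fullv.
Proof.
move=> hZ.
have h30 : (hodge 3 0 Z <= H)%VS by rewrite -!addvA addvSl.
have h21 : (hodge 2 1 Z <= H)%VS.
  by rewrite -addvA; apply: subv_trans (addvSl _ _); exact: addvSr.
have h12 : (hodge 1 2 Z <= H)%VS.
  by apply: subv_trans (addvSl _ _); exact: addvSr.
have h03 : (hodge 0 3 Z <= H)%VS by exact: addvSr.
have hx x : exists p m, [/\ p \in P, m \in M & x = p + m].
  have : x \in (P + M)%VS by rewrite Vplus_Vminus ?memvf.
  by case/memv_addP => p pP [m mM ->]; exists p, m.
have hT (x y w : ext K (3 + 3) 1) : wedge x (wedge y w) \in H.
  have [xp [xm [xpP xmM ->]]] := hx x; have [yp [ym [ypP ymM ->]]] := hx y.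
  have [wp [wm [wpP wmM ->]]] := hx w.
  (* Eight products arise; anticommutativity brings the factors from [P] in front of those from
     [M]. *)
  rewrite !(wedgeDl, wedgeDr) !memvD //.
  - by apply: (subvP h30); exact: mem_hodge30.
  - by apply: (subvP h21); exact: mem_hodge21.
  - rewrite [wedge ym _]wedge11C wedgeNr memvN.
    by apply: (subvP h21); exact: mem_hodge21.
  - by apply: (subvP h12); exact: mem_hodge12.
  - rewrite wedge111CA [wedge xm _]wedge11C wedgeNr opprK.
    by apply: (subvP h21); exact: mem_hodge21.
  - by rewrite wedge111CA memvN; apply: (subvP h12); exact: mem_hodge12.
  - rewrite [wedge ym _]wedge11C wedgeNr wedge111CA opprK.
    by apply: (subvP h12); exact: mem_hodge12.
  - by apply: (subvP h03); exact: mem_hodge03.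
apply/eqP; rewrite eqEsubv subvf; apply/subvP => u _ /=.
rewrite (ext_sum_ebase u); apply: memv_suml => A /eqP hA; apply: memvZ.
(* Splitting [A] into three singletons writes e_A, up to sign, as a product of three vectors, to
   which [hT] applies. *)
have [a aA] : exists a, a \in A by apply/set0Pn; rewrite -card_gt0 hA.
have hAa : #|A :\ a| == 2 by move: (cardsD1 a A); rewrite hA aA add1n => -[<-].
have /cards2P[b [c [bc Abc]]] := hAa.
have ebU p q (B C : {set 'I_(3 + 3)}) : #|B| = p -> #|C| = q -> [disjoint B & C] ->
    ebase (B :|: C) = (-1) ^+ inversions B C *: wedge (ebase B) (ebase C)
      :> ext K (3 + 3) (p + q).
  by move=> hB hC BC; rewrite wedge_ebase // scalerA -expr2 sqrr_sign scale1r.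
rewrite -(setD1K aA) (ebU 1 2 _ _ (cards1 _) (eqP hAa)); last first.
  by rewrite disjoints1 !inE eqxx.
rewrite Abc (ebU 1 1 _ _ (cards1 _) (cards1 _)); last by rewrite disjoints1 inE.
by rewrite wedgeZr; apply/memvZ/memvZ; exact: hT.
Qed.

Lemma dim_hodge_le : [/\ (\dim (hodge 3 0 Z) <= 1)%N, (\dim (hodge 2 1 Z) <= 9)%N,
  (\dim (hodge 1 2 Z) <= 9)%N & (\dim (hodge 0 3 Z) <= 1)%N].
Proof.
split; apply: leq_trans (dim_wedgev _ _) _.
- by rewrite dim_extpow0 muln1; exact: dim_extpow3_le.
- exact: leq_mul (dim_extpow2_le _) (dim_extpow1_le _).
- exact: leq_mul (dim_extpow1_le _) (dim_extpow2_le _).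
- by rewrite dim_extpow0 mul1n; exact: dim_extpow3_le.
Qed.

Lemma dim_hodge : SM Z ->
  [/\ \dim (hodge 3 0 Z) = 1%N, \dim (hodge 2 1 Z) = 9%N,
      \dim (hodge 1 2 Z) = 9%N & \dim (hodge 0 3 Z) = 1%N].
Proof.
move=> hZ; have [d30 d21 d12 d03] := dim_hodge_le.
have : (20 <= \dim (hodge 3 0 Z) + \dim (hodge 2 1 Z) + \dim (hodge 1 2 Z)
              + \dim (hodge 0 3 Z))%N.
  have <- : \dim {: L3 K} = 20%N by rewrite dim_ext.
  rewrite -hodge_sum_full //.
  apply: leq_trans (dimv_add_leqif _ _) _; rewrite leq_add2r.
  apply: leq_trans (dimv_add_leqif _ _) _; rewrite leq_add2r.
  exact: dimv_add_leqif.
move: (\dim _) (\dim _) (\dim _) (\dim _) d30 d21 d12 d03 => a b c d *.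
by split; lia.
Qed.

Lemma directv_hodge : SM Z -> directv H.
Proof.
move=> hZ; rewrite directvE /= hodge_sum_full // dim_ext.
by have [-> -> -> ->] := dim_hodge hZ.
Qed.

Lemma Omega_neq0 : Omega Z != 0.
Proof.
apply/negP => /eqP O0; have := t00_Omega Z.
by rewrite O0 /t00 coef_ext0 => /eqP; rewrite eq_sym oner_eq0.
Qed.

(** Omega is a nonzero element of a piece of dimension 1. *)
Lemma hodge30 : SM Z -> (hodge 3 0 Z : {vspace L3 K}) = <[Omega Z]>%VS.
Proof.
move=> hZ; apply/esym/eqP; rewrite eqEdim dim_vline Omega_neq0.
have [-> _ _ _] := dim_hodge hZ; rewrite leqnn andbT -memvE.
by rewrite /Omega -wedge111A mem_hodge30 // f_Vplus.
Qed.

End Hodge.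

(** * Derivatives *)

Section PolynomialCurves.
Local Open Scope classical_set_scope.
Context {K : numFieldType} {V W : normedModType K}.

(** For [s] nonzero the difference quotient equals a + s b + s^2 c, which tends to [a]. *)
Lemma is_derive_cubic (h : V -> W) x v a b c :
  (forall s : K, h (s *: v + x) = h x + s *: (a + s *: (b + s *: c))) ->
  is_derive x v h a.
Proof.
move=> hE.
have q_cvg : (fun s : K => s^-1 *: ((h \o shift x) (s *: v) - h x)) @ 0^' --> a.
  have p_cvg : (fun s : K => a + s *: (b + s *: c)) @ (0 : K) --> a.
    have c0 : s @[s --> (0 : K)] --> (0 : K) by move=> A.
    have c1 : s *: c @[s --> (0 : K)] --> (0 : K) *: c.
      by apply: (cvgZr_tmp (F := nbhs (0 : K))).
    have c2 : b + s *: c @[s --> (0 : K)] --> b + (0 : K) *: c.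
      apply: (cvgD (F := nbhs (0 : K)) (f := fun=> b)) => //.
      exact: (@cvg_cst _ _ _ (nbhs (0 : K)) _).
    have c3 : s *: (b + s *: c) @[s --> (0 : K)] --> (0 : K) *: (b + (0 : K) *: c).
      exact: (cvgZ (F := nbhs (0 : K)) c0 c2).
    have c4 : a + s *: (b + s *: c) @[s --> (0 : K)] -->
        a + (0 : K) *: (b + (0 : K) *: c).
      apply: (cvgD (F := nbhs (0 : K)) (f := fun=> a)) => //.
      exact: (@cvg_cst _ _ _ (nbhs (0 : K)) _).
    by rewrite scale0r addr0 in c4.
  apply: cvg_trans (cvg_within_filter _ p_cvg).
  apply: near_eq_cvg; near=> s.
  have s0 : s != 0 by near: s; exact: nbhs_dnbhs_neq.
  by rewrite /= hE addrAC subrr add0r scalerA mulVf // scale1r.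
by apply: DeriveDef; [apply/cvg_ex; exists a|exact: cvg_lim].
Unshelve. all: by end_near. Qed.

Lemma is_derive_affine (h : V -> W) x v a :
  (forall s : K, h (s *: v + x) = h x + s *: a) -> is_derive x v h a.
Proof.
move=> hE; apply: (@is_derive_cubic _ _ _ _ 0 0) => s;
  by rewrite hE !scaler0 !addr0 ?scaler0 ?addr0.
Qed.

(** The differential is evaluated as a directional derivative, along a line on which [h] is affine
    with slope [h v]. *)
Lemma diff_additive (h : V -> W) x v :
  differentiable h x -> (forall s : K, h (s *: v + x) = h x + s *: h v) ->
  'd h x v = h v.
Proof.
by move=> dh hE; rewrite -deriveE //; apply: derive_val; exact: is_derive_affine.
Qed.

End PolynomialCurves.

(** * Determinants and coefficients as differentiable functions *)

Section Derivatives.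
Context {K : numFieldType}.

(** In the expansion along row [i], the only row changed, the cofactors do not involve that row. *)
Lemma det_add_delta n (Z : 'M[K]_n) i j s :
  \det (s *: delta_mx i j + Z) = \det Z + s * cofactor Z i j.
Proof.
rewrite !(expand_det_row _ i).
have E k : cofactor (s *: delta_mx i j + Z) i k = cofactor Z i k.
  rewrite /cofactor; congr (_ * \det _); apply/matrixP => a b; rewrite !mxE.
  by rewrite eq_sym (negbTE (neq_lift i a)) mulr0 add0r.
under eq_bigr => k _ do rewrite E !mxE eqxx /= mulrDl addrC.
rewrite big_split /=; congr (_ + _).
rewrite (bigD1 j) //= eqxx mulr1 big1 ?addr0 // => k kj.
by rewrite (negbTE kj) mulr0 mul0r.
Qed.

(** The Leibniz formula is a finite sum of products of coordinates. *)
Lemma differentiable_det n (Z : 'M[K]_n) : differentiable (determinant : 'M[K]_n -> K) Z.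
Proof.
have -> : (determinant : 'M[K]_n -> K) = \sum_(p : 'S_n)
    (cst ((-1) ^+ p : K) * \prod_i (fun M : 'M[K]_n => M i (p i))).
  by apply/funext => M; rewrite fct_sumE; apply: eq_bigr => p _; rewrite /= fct_prodE.
apply: (big_ind (fun h : 'M[K]_n -> K => differentiable h Z)) => [||p _];
  first exact: differentiable_cst.
  by move=> h1 h2; exact: differentiableD.
apply: differentiableM; first exact: differentiable_cst.
apply: (big_ind (fun h : 'M[K]_n -> K => differentiable h Z)) => [||i _];
  first exact: differentiable_cst.
  by move=> h1 h2; exact: differentiableM.
exact: differentiable_coord.
Qed.

Lemma differentiable_coef n k (A : {set 'I_n}) (w : ext K n k) :
  differentiable (fun u : ext K n k => coef u A : K) w.
Proof.
rewrite /coef; case: insub => [B|] /=; first exact: differentiable_coord.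
exact: differentiable_cst.
Qed.

End Derivatives.

(** * The two-form, the prepotential and the Leibniz rule for triple products *)

Section LambdaThreeDerivatives.
Context {K : numClosedFieldType}.
Implicit Types (Z v lambda : 'M[K]_3).

Lemma ddz_det i j Z : ddz i j (fun Y : 'M[K]_3 => \det Y) Z = cofactor Z i j.
Proof.
apply: derive_val; apply: is_derive_affine => s.
by rewrite det_add_delta.
Qed.

Lemma diff_coef n k c (A : {set 'I_n}) (w u : ext K n k) :
  'd (fun u : ext K n k => c * coef u A : K) w u = c * coef u A.
Proof.
apply: (diff_additive (h := fun u : ext K n k => c * coef u A : K)) => [|s].
  by apply: differentiableM; [exact: differentiable_cst|exact: differentiable_coef].
by rewrite coef_extD coef_extZ mulrDr addrC mulrCA.
Qed.

Lemma dwedge_coef n k c (A B : {set 'I_n}) (w u v : ext K n k) :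
  dwedge (fun u : ext K n k => coef u A : K) (fun u => c * coef u B : K) w u v =
  c * (coef u A * coef v B - coef u B * coef v A).
Proof.
rewrite /dwedge !diff_coef.
(* A factor 1 is inserted to match the shape of [diff_coef]. *)
have -> : (fun u : ext K n k => coef u A : K) = (fun u => 1 * coef u A).
  by apply/funext => x; rewrite mul1r.
rewrite !diff_coef; ring.
Qed.

(** The coordinates are linear, hence equal to their differentials at every point [x], and the
    identity becomes [Q_expand]. *)
Lemma Q_dwedge (x u v : L3 K) :
  Q u v = dwedge F00 tbar00 x u v
          + \sum_i \sum_j dwedge (F i j) (tbar i j) x u v.
Proof.
rewrite Q_expand; congr (_ + _).
  have := dwedge_coef 1 los his x u v.
  rewrite (_ : (fun u => 1 * _) = tbar00); last first.
    by apply/funext => y; rewrite mul1r.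
  by rewrite mul1r => ->.
by apply: eq_bigr => i _; apply: eq_bigr => j _; rewrite dwedge_coef.
Qed.

(** Over the complex numbers this is holomorphy away from the hyperplane where the first coordinate
    vanishes. *)
Lemma prepotential_differentiable (x : K * 'M[K]_3) :
  x.1 != 0 -> differentiable prepotential x.
Proof.
move=> x0; apply: differentiableN; apply: differentiableM.
  apply: (@differentiable_comp _ _ _ _ snd determinant).
    by apply: linear_differentiable; move=> p; exact: cvg_snd.
  exact: differentiable_det.
apply: (@differentiableV _ _ (fst : K * 'M[K]_3 -> K)) => //.
by apply: linear_differentiable; move=> p; exact: cvg_fst.
Qed.

(** In this direction the determinant is constant and only the inverse of the first coordinate
    varies. *)
Lemma derive_prepotential0 (x : K * 'M[K]_3) : x.1 != 0 ->
  'D_((1, 0) : K * 'M[K]_3) prepotential x = \det x.2 / x.1 ^+ 2.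
Proof.
move=> x0; pose dv (y : K * 'M[K]_3) := \det y.2.
have d_det : is_derive x ((1, 0) : K * 'M[K]_3) dv 0.
  by apply: is_derive_affine => s; rewrite /dv /= !scaler0 add0r addr0.
have d_fst : is_derive x ((1, 0) : K * 'M[K]_3) (fst : _ -> K) 1.
  by apply: is_derive_affine => s; rewrite /= addrC.
have d_inv : is_derive x ((1, 0) : K * 'M[K]_3) (fun y => y.1^-1) (- x.1 ^- 2).
  apply: DeriveDef; first exact: derivableV.
  by rewrite deriveV // derive_val [_ *: _]mulr1.
have -> : prepotential = - (dv * (fun y => y.1^-1)) by [].
by rewrite derive_val scaler0 addr0 -[LHS]mulrN opprK.
Qed.

Lemma derive_prepotential i j (x : K * 'M[K]_3) :
  'D_((0, delta_mx i j) : K * 'M[K]_3) prepotential x = - (cofactor x.2 i j / x.1).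
Proof.
apply: derive_val; apply: is_derive_affine => s.
rewrite /prepotential /= scaler0 add0r det_add_delta mulrDl opprD.
by congr (_ + _); rewrite -mulrA -[LHS]mulrN.
Qed.

(** Linearity in the direction collects the partial derivatives into the single derivative along
    [lambda]. *)
Lemma vfieldE (W : normedModType K) lambda (h : 'M[K]_3 -> W) (dh : 'M[K]_3 -> W) Z :
  linear dh -> (forall v, is_derive Z v h (dh v)) -> vfield lambda h Z = dh lambda.
Proof.
move=> dh_lin hdh.
pose dhM := GRing.isLinear.Build _ _ _ _ _ dh_lin.
pose dhL : {linear 'M[K]_3 -> W} := HB.pack dh dhM.
rewrite [in RHS](matrix_sum_delta lambda) -[dh]/(dhL : _ -> _) linear_sum.
apply: eq_bigr => i _; rewrite linear_sum; apply: eq_bigr => j _.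
by rewrite linearZ_LR; congr (_ *: _); apply: derive_val.
Qed.

(** The derivative is required at every point, so that [vfield lambda h] is known as a function and
    can be differentiated again. *)
Definition has_vfield (W : normedModType K) (h : 'M[K]_3 -> W)
    (dh : 'M[K]_3 -> 'M[K]_3 -> W) :=
  forall Z, linear (dh Z) /\ forall v, is_derive Z v h (dh Z v).

Lemma vfield_fun (W : normedModType K) lambda (h : 'M[K]_3 -> W) dh :
  has_vfield h dh -> vfield lambda h = dh^~ lambda.
Proof. by move=> hdh; apply/funext => Z; have [? ?] := hdh Z; exact: vfieldE. Qed.

Lemma has_vfieldD (W : normedModType K) (h1 h2 : 'M[K]_3 -> W) dh1 dh2 :
  has_vfield h1 dh1 -> has_vfield h2 dh2 ->
  has_vfield (fun Z => h1 Z + h2 Z) (fun Z v => dh1 Z v + dh2 Z v).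
Proof.
move=> H1 H2 Z; have [l1 d1] := H1 Z; have [l2 d2] := H2 Z; split=> [a u v|v].
  by rewrite l1 l2 scalerDr addrACA.
exact: is_deriveD.
Qed.

(** The vector l_j, the part of [f Z j] that is linear in the matrix. *)
Definition slope j v : ext K (3 + 3) 1 := \sum_i v i j *: elo i.

(* [wfactor b] is the j-th factor of Omega, differentiated along lambda if [b]
   holds; being affine in Z, a factor is differentiated at most once. *)
Definition wfactor (b : bool) lambda Z j := if b then slope j lambda else f Z j.

Definition dwfactor (b : bool) j v := if b then 0 else slope j v.

Lemma slope_linear j : linear (slope j).
Proof.
move=> a u v; rewrite /slope scaler_sumr -big_split /=; apply: eq_bigr => i _.
by rewrite !mxE scalerDl scalerA.
Qed.

Lemma dwfactor_linear b j : linear (dwfactor b j).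
Proof. by case: b => a u v; [rewrite /= scaler0 addr0|exact: slope_linear]. Qed.

Lemma wfactor_affine b lambda j s v Z :
  wfactor b lambda (s *: v + Z) j = s *: dwfactor b j v + wfactor b lambda Z j.
Proof.
case: b; rewrite /= ?scaler0 ?add0r // /f addrA; congr (_ + _).
rewrite scaler_sumr -big_split /=; apply: eq_bigr => i _.
by rewrite !mxE scalerDl scalerA.
Qed.

(** This is the Leibniz rule; the flags let one statement serve for all three successive
    differentiations. *)
Lemma has_vfield_wedge b0 b1 b2 lambda :
  let A b j Z := wfactor b lambda Z j in
  has_vfield (fun Z => wedge (wedge (A b0 0 Z) (A b1 1 Z)) (A b2 2 Z) : L3 K)
    (fun Z v => wedge (wedge (dwfactor b0 0 v) (A b1 1 Z)) (A b2 2 Z)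
      + wedge (wedge (A b0 0 Z) (dwfactor b1 1 v)) (A b2 2 Z)
      + wedge (wedge (A b0 0 Z) (A b1 1 Z)) (dwfactor b2 2 v) : L3 K).
Proof.
move=> A Z; split=> [a u v|v].
  rewrite !dwfactor_linear !(wedgeDl, wedgeDr, wedgeZl, wedgeZr) !scalerDr.
  by apply: ext_eqP => C; rewrite !(coef_extD, coef_extZ); ring.
(* The two explicit arguments are the coefficients of s^2 and s^3 in the expanded product. *)
apply: (@is_derive_cubic _ _ _ _ _ _ _
  (wedge (wedge (dwfactor b0 0 v) (dwfactor b1 1 v)) (A b2 2 Z)
   + wedge (wedge (dwfactor b0 0 v) (A b1 1 Z)) (dwfactor b2 2 v)
   + wedge (wedge (A b0 0 Z) (dwfactor b1 1 v)) (dwfactor b2 2 v))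
  (wedge (wedge (dwfactor b0 0 v) (dwfactor b1 1 v)) (dwfactor b2 2 v))) => s.
rewrite /A !wfactor_affine !(wedgeDl, wedgeDr, wedgeZl, wedgeZr).
by apply: ext_eqP => C; rewrite !(coef_extD, coef_extZ); ring.
Qed.

End LambdaThreeDerivatives.

(** * The Yukawa coupling *)

Section Yukawa.
Context {K : numClosedFieldType}.
Implicit Types (Z v lambda : 'M[K]_3).

Lemma coef_slope_lo v j k : coef (slope j v) [set lo k] = v k j.
Proof.
rewrite /slope coef_ext_sum (bigD1 k) //= coef_extZ coef_ebase ?cards1 // eqxx mulr1.
rewrite big1 ?addr0 // => i ik; rewrite coef_extZ coef_ebase ?cards1 //.
by rewrite (inj_eq set1_inj) lohiE eq_sym (negbTE ik) mulr0.
Qed.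

Lemma coef_slope_hi v j k : coef (slope j v) [set hi k] = 0.
Proof.
rewrite /slope coef_ext_sum big1 // => i _.
by rewrite coef_extZ coef_ebase ?cards1 // (inj_eq set1_inj) lohiE mulr0.
Qed.

(** The slopes have no component on e_4, e_5, e_6, so their product is det(v) e_1 /\ e_2 /\ e_3 and
    only the term - t00 F00 of the pairing survives. *)
Lemma Q_Omega_slope Z v :
  Q (Omega Z) (wedge (wedge (slope 0 v) (slope 1 v)) (slope 2 v)) = - \det v.
Proof.
set w : L3 K := wedge (wedge (slope 0 v) (slope 1 v)) (slope 2 v).
have t0 i j : t i j w = 0.
  rewrite /t tset3 coef_wedge111; first last.
  - by elim/ord3P: j.
  - by rewrite /= ltn_addr.
  by rewrite !coef_slope_hi; ring.
have F0 i j : F i j w = 0.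
  rewrite /F Fset3 coef_wedge111; first last.
  - by rewrite /= ltn_addr.
  - by elim/ord3P: i.
  by rewrite !coef_slope_hi; ring.
have t00w : t00 w = 0 by rewrite /t00 his3 coef_wedge111 // !coef_slope_hi; ring.
have F00w : F00 w = \det v.
  by rewrite /F00 los3 coef_wedge111 // !coef_slope_lo det3; ring.
rewrite Q_expand t00w F00w t00_Omega mulr0 sub0r mul1r big1 ?addr0 // => i _.
by rewrite big1 // => j _; rewrite t0 F0 !mulr0 subr0 mulr0.
Qed.

(** Each factor must be differentiated exactly once; the coefficient 6 counts the orders in which
    this happens. *)
Lemma vfield3_Omega lambda Z :
  vfield lambda (vfield lambda (vfield lambda Omega)) Z =
    6%:R *: wedge (wedge (slope 0 lambda) (slope 1 lambda)) (slope 2 lambda).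
Proof.
pose m (b0 b1 b2 : bool) (Y : 'M[K]_3) : L3 K :=
  wedge (wedge (wfactor b0 lambda Y 0) (wfactor b1 lambda Y 1))
  (wfactor b2 lambda Y 2).
have hm (b0 b1 b2 : bool) := has_vfield_wedge b0 b1 b2 lambda.
have -> : vfield lambda (@Omega K) =
    fun Y => m true false false Y + m false true false Y + m false false true Y.
  by rewrite (vfield_fun _ (hm false false false)).
rewrite (vfield_fun _ (has_vfieldD (has_vfieldD (hm true false false)
  (hm false true false)) (hm false false true))) /=.
(* Terms with a factor differentiated twice vanish; each pair of differentiated factors arises in
   two orders. *)
rewrite [X in vfield lambda X](_ : _ = fun Y : 'M[K]_3 =>
    m true true false Y + m true true false Y + m true false true Y
    + m true false true Y + m false true true Y + m false true true Y); last first.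
  apply/funext => Y; rewrite !(wedge0l, wedge0r) !(add0r, addr0) /m /=.
  by apply: ext_eqP => C; rewrite !coef_extD; ring.
rewrite (vfield_fun _ (has_vfieldD (has_vfieldD (has_vfieldD (has_vfieldD (has_vfieldD
  (hm true true false) (hm true true false)) (hm true false true))
  (hm true false true)) (hm false true true)) (hm false true true))) /=.
rewrite !(wedge0l, wedge0r) !(add0r, addr0).
by apply: ext_eqP => C; rewrite !coef_extD coef_extZ; ring.
Qed.

Lemma yukawa lambda Z :
  Q (Omega Z) (vfield lambda (vfield lambda (vfield lambda Omega)) Z)
  = - 6%:R * \det lambda.
Proof.
by rewrite vfield3_Omega /Q wedgeZr coef_extZ -/(Q _ _) Q_Omega_slope mulrN mulNr.
Qed.

End Yukawa.

(** * The Hodge structure, period coordinates, symplectic form, prepotential and cubic form *)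

Theorem mainTheorem5 (R : realType) (Z : 'M[CC R]_3) (hZ : SM Z)
    (s : CC R) (hs : s != 0) :
  let w : L3 (CC R) := s *: Omega Z in
  [/\
    (* Omega Z generates the (3,0)-part; the Hodge numbers are 1, 9, 9, 1 *)
    [/\ Omega Z != 0,
        (hodge 3 0 Z : {vspace L3 (CC R)}) = <[Omega Z]>%VS,
        [/\ \dim (hodge 3 0 Z) = 1%N, \dim (hodge 2 1 Z) = 9%N,
            \dim (hodge 1 2 Z) = 9%N & \dim (hodge 0 3 Z) = 1%N],
        ((hodge 3 0 Z : {vspace L3 (CC R)}) + hodge 2 1 Z + hodge 1 2 Z
          + hodge 0 3 Z)%VS = fullv
      & directv ((hodge 3 0 Z : {vspace L3 (CC R)}) + hodge 2 1 Z
          + hodge 1 2 Z + hodge 0 3 Z)%VS],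
    (* item 1 *)
    [/\ t00 w = s,
        forall i j, t i j w = s * (-1) ^+ (j.+1 + 1) * Z i j,
        F00 w = s * \det Z
      & forall i j,
          F i j w = s * (-1) ^+ (i.+1 + 1) * ddz i j (fun Y => \det Y) Z],
    (* item 2 *)
    forall x u v : L3 (CC R),
      Q u v = dwedge F00 tbar00 x u v
              + \sum_i \sum_j dwedge (F i j) (tbar i j) x u v,
    (* item 3 *)
    [/\ forall x : CC R * 'M[CC R]_3,
          x.1 != 0 -> differentiable prepotential x,
        F00 w = 'D_((1, 0) : CC R * 'M[CC R]_3) prepotential
                  (tbar00 w, tbarmx w)
      & forall i j,
          F i j w = 'D_((0, delta_mx i j) : CC R * 'M[CC R]_3) prepotential
                      (tbar00 w, tbarmx w)]
    (* item 4 *)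
  & forall lambda : 'M[CC R]_3,
      Q (Omega Z) (vfield lambda (vfield lambda (vfield lambda Omega)) Z)
      = - 6%:R * \det lambda].
Proof.
have F00Z c (x : L3 (CC R)) : F00 (c *: x) = c * F00 x by exact: coef_extZ.
have t00Z c (x : L3 (CC R)) : t00 (c *: x) = c * t00 x by exact: coef_extZ.
have FZ i j c (x : L3 (CC R)) : F i j (c *: x) = c * F i j x by exact: coef_extZ.
have tZ i j c (x : L3 (CC R)) : t i j (c *: x) = c * t i j x by exact: coef_extZ.
move=> w.
have w00 : tbar00 w = s by rewrite /tbar00 t00Z t00_Omega mulr1.
(* With indices from 1, the signs (-1)^(i+j+1) and (-1)^(j+1) combine to (-1)^i: the matrix is s Z
   with first and third rows negated, of determinant s^3 det Z. *)
have wij : tbarmx w = \matrix_(i, j) (s * (-1) ^+ i.+1 * Z i j).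
  apply/matrixP => i j; rewrite !mxE /tbar tZ t_Omega.
  by elim/ord3P: i; elim/ord3P: j; rewrite /=; ring.
split.
- by split; [exact: Omega_neq0 | exact: hodge30 | exact: dim_hodge
            | exact: hodge_sum_full | exact: directv_hodge].
- split=> [|i j||i j].
  + by rewrite t00Z t00_Omega mulr1.
  + by rewrite tZ t_Omega mulrA.
  + by rewrite F00Z F00_Omega.
  + by rewrite FZ F_Omega ddz_det mulrA.
- exact: Q_dwedge.
- split=> [x||i j]; first exact: prepotential_differentiable.
  + rewrite derive_prepotential0 /= w00 // wij F00Z F00_Omega !det3 !mxE /=.
    by field.
  (* The row signs give this matrix the cofactor s^2 (-1)^i times that of [Z], and - 1 / s turns it
     into s (-1)^(i+1) times that of [Z]. *)
  + rewrite derive_prepotential /= w00 wij FZ F_Omega !cofactor3 !mxE.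
    by elim/ord3P: i; elim/ord3P: j; rewrite /fst_other /snd_other /=; field.
- move=> lambda; exact: yukawa.
Qed.
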